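(* Let $S$ be a semilattice-ordered semigroup and let $\mathrm{cl}$ be an algebraic, order-compatible closure operator on $S$. Let $X=\{A\in\mathcal{P}(S)\mid A^{\mathrm{cl}}=A\}$. If the poset $(S,\leqslant)$ is well-quasi-ordered, then the map $\star:X\times X\to X$, $A\star B=(AB)^{\mathrm{cl}}$, is spectral.
   Context: A semilattice-ordered semigroup is a triple $(S,\cdot,\lor)$ with $S$ nonempty, $(S,\cdot)$ a semigroup, $(S,\lor)$ a semilattice (commutative, associative, idempotent), and $x(y\lor z)=xy\lor xz$, $(x\lor y)z=xz\lor yz$ for all $x,y,z\in S$. It is partially ordered by $x\leqslant y\iff x\lor y=y$. For $A,B\subseteq S$, $AB=\{ab\mid a\in A,b\in B\}$. $\mathcal{P}(S)$ is the power set of $S$ and $\mathcal{P}_{\mathrm{fin}}(A)$ is the set of finite subsets of $A$. A closure operator on $S$ is a map $\mathrm{cl}:\mathcal{P}(S)\to\mathcal{P}(S)$, written $A\mapsto A^{\mathrm{cl}}$, which is extensive, idempotent and order-preserving for inclusion. It is algebraic if $A^{\mathrm{cl}}=\bigcup\{F^{\mathrm{cl}}\mid F\in\mathcal{P}_{\mathrm{fin}}(A)\}$ for every $A\subseteq S$, and order-compatible if $x\leqslant y$ implies $\{x\}^{\mathrm{cl}}\subseteq\{y\}^{\mathrm{cl}}$ for all $x,y\in S$. A preordered set $(P,\leqslant)$ is well-quasi-ordered if every infinite sequence $(x_n)_{n\in\mathbb{N}}$ in $P$ admits indices $m<n$ with $x_m\leqslant x_n$. The hull-kernel topology on $\mathcal{P}(S)$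 has open subbasis $D(F)=\{A\in\mathcal{P}(S)\mid F\nsubseteq A\}$, $F\in\mathcal{P}_{\mathrm{fin}}(S)$. $X$ carries the subspace topology; since $\mathrm{cl}$ is algebraic, $X$ is a spectral space (quasi-compact, $T_0$, sober, with quasi-compact opens closed under finite intersections and forming a basis), and $X\times X$ with the product topology is a spectral space. A map between spectral spaces is spectral if the preimage of every quasi-compact open set is quasi-compact and open. *)

(* Defs.v *)
From HB Require Import structures.
From mathcomp Require Import all_boot all_order.
From mathcomp Require Import all_classical.
From mathcomp Require Import topology.

Set Implicit Arguments.
Unset Strict Implicit.
Unset Printing Implicit Defensive.

Local Open Scope order_scope.
Local Open Scope group_scope.
Local Open Scope classical_set_scope.

(* The order of the underlying join-semilattice is the usual one:
   x <= y iff x `|` y = y (Order.JoinTheory.leEjoin). *)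
HB.mixin Record isSemilatticeOrderedSemigroup (d : Order.disp_t) S
    of Semigroup S & Order.JoinSemilattice d S := {
  sosg_nonempty : inhabited S;
  mulg_joinr : forall x y z : S,
    x * (y `|` z)%O = ((x * y) `|` (x * z))%O;
  mulg_joinl : forall x y z : S,
    (x `|` y)%O * z = ((x * z) `|` (y * z))%O
}.

#[short(type="semilatticeOrderedSemigroupType")]
HB.structure Definition SemilatticeOrderedSemigroup (d : Order.disp_t) :=
  { S of Semigroup S & Order.JoinSemilattice d S
       & isSemilatticeOrderedSemigroup d S }.

Definition set_mul (S : semigroupType) (A B : set S) : set S :=
  [set a * b | a in A & b in B].

Definition well_quasi_ordered (d : Order.disp_t) (P : preorderType d) : Prop :=
  forall x : nat -> P, exists m n : nat, (m < n)%N /\ (x m <= x n)%O.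

Record closure_operator (S : Type) := ClosureOperator {
  cl_fun :> set S -> set S;
  cl_extensive : forall A, A `<=` cl_fun A;
  cl_idempotent : forall A, cl_fun (cl_fun A) = cl_fun A;
  cl_monotone : forall A B, A `<=` B -> cl_fun A `<=` cl_fun B
}.

Definition algebraic (S : Type) (cl : closure_operator S) : Prop :=
  forall A, cl A = \bigcup_(F in [set F | finite_set F /\ F `<=` A]) cl F.

Definition order_compatible (d : Order.disp_t) (S : porderType d)
    (cl : closure_operator S) : Prop :=
  forall x y : S, (x <= y)%O -> cl [set x] `<=` cl [set y].

(* Type alias of set S, so that the hull-kernel topology can be attached to it
   without interfering with other structures on set S. *)
Definition hull_kernel (S : Type) : Type := set S.

HB.instance Definition _ (S : Type) := Choice.copy (hull_kernel S) (set S).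

HB.instance Definition _ (S : Type) :=
  isSubBaseTopological.Build (hull_kernel S)
    [set F : set S | finite_set F]
    (fun F => [set A : hull_kernel S | ~ (F `<=` (A : set S))]).

(* As a type (set_type), closed_sets cl carries the initial topology of its
   inclusion into hull_kernel S, i.e., the subspace topology. *)
Definition closed_sets (S : Type) (cl : closure_operator S) :
  set (hull_kernel S) := [set A | cl A = A].

Definition star (S : semigroupType) (cl : closure_operator S)
    (AB : closed_sets cl * closed_sets cl) : closed_sets cl :=
  SigSub (mem_set (cl_idempotent cl (set_mul (\val AB.1) (\val AB.2)))
    : (cl (set_mul (\val AB.1) (\val AB.2)) : hull_kernel S)
        \in closed_sets cl).

(* compact does not include any separation axiom, i.e., it is
   quasi-compactness. *)
Definition spectral_map (X Y : topologicalType) (f : X -> Y) : Prop :=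
  forall U : set Y, open U -> compact U ->
    compact (f @^-1` U) /\ open (f @^-1` U).

(* Main.v *)
Require Import Defs.
From mathcomp Require Import all_boot all_order.
From mathcomp Require Import finmap.
From mathcomp Require Import all_classical.
From mathcomp Require Import topology.

(** Since [cl] is order-compatible, closed sets are down-sets of [S].  When [S]
    is well-quasi-ordered, the complement of a closed set [A] is the up-closure
    of a finite set [M], so the closed sets contained in [A] are those that
    avoid [M]: they form an open set ([nbhs_subsets]).  As open sets of [X] are
    always stable under passing to smaller closed sets ([open_subset_closed]),
    the open sets of [X] are exactly the families with that stability, and
    [star] is continuous simply because it is monotone for inclusion.

    For compactness of the preimage of a compact open [O], take an ultrafilter
    [U] on [X * X] containing that preimage, and let [A] (resp. [B]) consist of
    the elements that belong to [U]-almost every first (resp. second)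
    component.  Algebraicity makes [A] and [B] closed ([cl_liminf]), and the
    same finite set [M] shows that [U]-almost all pairs are componentwise
    contained in [(A, B)] ([ultra_subset_liminf]), whence [U] converges to
    [(A, B)].  It remains to see that [star (A, B)] is in [O].  By compactness
    of [O], the image of [U] under [star] clusters at some [C] in [O], and so
    [star] maps [U]-almost all pairs to subsets of [C].  A product [a * b] with
    [a] in [A] and [b] in [B] lies in [star] of [U]-almost all pairs, hence in
    [C].  Thus [star (A, B)] is contained in [C], and it is in [O] because [O]
    is stable under passing to smaller closed sets. *)

Set Implicit Arguments.
Unset Strict Implicit.
Unset Printing Implicit Defensive.

Local Open Scope classical_set_scope.

(** * Finite bases and filters *)

(** Otherwise one could pick forever elements of [D] above none of the previous
    ones, and these would form a bad sequence. *)
Lemma wqo_finite_basis (d : Order.disp_t) (P : preorderType d) (D : set P) :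
  well_quasi_ordered P ->
  exists M : set P, [/\ finite_set M, M `<=` D &
    forall x, D x -> exists2 m, M m & (m <= x)%O].
Proof.
move=> wqoP; apply: contrapT => noM.
have next (s : seq P) : exists x, [set` s] `<=` D ->
    D x /\ forall m, m \in s -> ~~ (m <= x)%O.
  have [sD|/existsNP[x nsDx]] := pselect ([set` s] `<=` D); last first.
    by exists x => /(_ x)/nsDx.
  apply: contrapT => nx; apply: noM; exists [set` s]; split=> //.
  move=> x Dx; apply: contrapT => nm; apply: nx; exists x => _; split=> // m ms.
  by apply/negP => mx; apply: nm; exists m.
have [g gP] := choice next.
(* The list [s n] holds the first [n] terms of the bad sequence. *)
pose s := fix s n := if n is k.+1 then g (s k) :: s k else [::].
have sD n : [set` s n] `<=` D.
  elim: n => [|n IHn] x //=; rewrite inE => /orP[/eqP ->|/IHn //].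
  by have [] := gP _ IHn.
have s_lt m n : (m < n)%N -> g (s m) \in s n.
  elim: n => // n IHn; rewrite ltnS leq_eqVlt => /orP[/eqP ->|/IHn mn] /=.
    exact: mem_head.
  by rewrite inE mn orbT.
have [m [n [mn le_mn]]] := wqoP (g \o s).
by have [_ /(_ _ (s_lt _ _ mn))] := gP _ (sD n); rewrite le_mn.
Qed.

Lemma filter_bigcap_finite (T : Type) (I : choiceType) (F : set_system T)
    (D : set I) (f : I -> set T) :
  Filter F -> finite_set D -> (forall i, D i -> F (f i)) ->
  F (\bigcap_(i in D) f i).
Proof.
move=> FF /finite_fsetP[E ->] Ff.
by apply: filter_bigI => i iE; apply: Ff.
Qed.

(** * Closed sets and their topology *)

Lemma closed_down (d : Order.disp_t) (S : porderType d)
    (cl : closure_operator S) (cl_ord : order_compatible cl)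
    (A : closed_sets cl) (x y : S) :
  (x <= y)%O -> \val A y -> \val A x.
Proof.
move=> xy Ay; rewrite -(set_valP A).
have yA : [set y] `<=` \val A by move=> _ ->.
by apply: (cl_monotone yA); apply: (cl_ord x y xy); apply: cl_extensive.
Qed.

(** Each subbasic open set, [F] not contained in [A], has this stability, which
    passes to finite intersections and to unions. *)
Lemma hull_kernel_open_subset (S : Type) (W : set (hull_kernel S))
    (A B : hull_kernel S) :
  open W -> (A : set S) `<=` B -> W B -> W A.
Proof.
move=> [D' sD' <-] AB [V D'V VB]; exists V => //.
have [E _ EV] := sD' _ D'V; rewrite -EV in VB *.
by move=> F /VB nFB FA; apply: nFB; apply: subset_trans AB.
Qed.

Lemma hull_kernel_open_notin (S : Type) (x : S) :
  open [set A : hull_kernel S | ~ (A : set S) x].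
Proof.
have -> : [set A : hull_kernel S | ~ (A : set S) x] =
    [set A : hull_kernel S | ~ ([set x] `<=` (A : set S))].
  by apply/seteqP; split=> A /= nAx Ax; apply: nAx; [exact: Ax|move=> _ ->].
set V := [set A | _].
exists [set V]; last by rewrite bigcup_set1.
move=> _ ->; exists [fset ([set x] : set S)]%fset.
  by move=> F /fset1P ->; apply: mem_set; exact: finite_set1.
by rewrite set_fset1 bigcap_set1.
Qed.

Lemma open_subset_closed (S : Type) (cl : closure_operator S)
    (O : set (closed_sets cl)) (A B : closed_sets cl) :
  open O -> \val A `<=` (\val B : set S) -> O B -> O A.
Proof. by move=> [W oW <-] AB; apply: hull_kernel_open_subset oW AB. Qed.

(** A down-set is contained in [A] as soon as it avoids a finite basis of the
    complement of [A], and avoiding one point is an open condition. *)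
Lemma nbhs_subsets (d : Order.disp_t) (S : porderType d)
    (cl : closure_operator S) (cl_ord : order_compatible cl)
    (S_wqo : well_quasi_ordered S) (A : closed_sets cl) :
  nbhs A [set A' : closed_sets cl | \val A' `<=` (\val A : set S)].
Proof.
have [M [finM MA basisM]] := wqo_finite_basis (~` \val A) S_wqo.
have nbhsM : nbhs A (\bigcap_(m in M) [set A' : closed_sets cl | ~ \val A' m]).
  apply: filter_bigcap_finite => // m Mm.
  apply: open_nbhs_nbhs; split; last exact: MA.
  by exists [set B : hull_kernel S | ~ (B : set S) m] => //;
    exact: hull_kernel_open_notin.
apply: filterS nbhsM => A' avoidM x A'x; apply: contrapT => nAx.
have [m Mm mx] := basisM x nAx.
exact: (avoidM m Mm (closed_down cl_ord mx A'x)).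
Qed.

(** * Limits of ultrafilters *)

(** For an ultrafilter [U], this is the limit of [f] along [U] for the product
    topology on the power set, each membership being a two-valued function; for
    a general filter it is the set-theoretic lower limit. *)
Definition liminf (T S : Type) (cl : closure_operator S) (U : set_system T)
    (f : T -> closed_sets cl) : set S :=
  [set s | \forall t \near U, (\val (f t) : set S) s].

(** By algebraicity, an element of the closure is witnessed by finitely many
    members of the lower limit, and [U]-almost every [f t] contains all of
    them. *)
Lemma cl_liminf (T : Type) (S : choiceType) (cl : closure_operator S)
    (cl_alg : algebraic cl) (U : set_system T) (f : T -> closed_sets cl) :
  Filter U -> cl (liminf U f) = liminf U f.
Proof.
move=> FU; rewrite eqEsubset; split; last exact: cl_extensive.
rewrite cl_alg => x [F [finF FU'] Fx].
have := filter_bigcap_finite FU finF FU'; apply: filterS => t Ft.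
by rewrite -(set_valP (f t)); apply: cl_monotone Fx => s Fs; apply: Ft.
Qed.

(** In general each point outside the limit avoids almost every [f t], with no
    uniformity in the point.  Well-quasi-order gives uniformity: it is enough to
    avoid a finite basis of the complement of the limit. *)
Lemma ultra_subset_liminf (T : Type) (d : Order.disp_t) (S : porderType d)
    (cl : closure_operator S) (cl_ord : order_compatible cl)
    (S_wqo : well_quasi_ordered S) (U : set_system T)
    (f : T -> closed_sets cl) :
  UltraFilter U -> \forall t \near U, \val (f t) `<=` liminf U f.
Proof.
move=> UU.
have [M [finM MA basisM]] := wqo_finite_basis (~` liminf U f) S_wqo.
have UM : U (\bigcap_(m in M) ~` [set t | \val (f t) m]).
  apply: filter_bigcap_finite => // m Mm.
  by have [/(MA m Mm)|] := in_ultra_setVsetC [set t | \val (f t) m] UU.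
apply: filterS UM => t avoidM x ftx; apply: contrapT => nx.
have [m Mm mx] := basisM x nx.
exact: (avoidM m Mm (closed_down cl_ord mx ftx)).
Qed.

(** * Spectrality of the product *)

Lemma star_subset (S : semigroupType) (cl : closure_operator S)
    (AB : closed_sets cl * closed_sets cl) (C : closed_sets cl) :
  (\val (star AB) `<=` (\val C : set S)) <->
  (forall a b, \val AB.1 a -> \val AB.2 b -> \val C (a * b)%g).
Proof.
split=> [starC a b Aa Bb|mulC].
  by apply: starC; apply: cl_extensive; exists a => //; exists b.
rewrite -(set_valP C); apply: cl_monotone => _ [a Aa [b Bb <-]].
exact: mulC.
Qed.

(** The pairs componentwise contained in [AB] form a neighbourhood of [AB], and
    [star] maps them to subsets of [star AB]. *)
Lemma star_continuous (d : Order.disp_t)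
    (S : semilatticeOrderedSemigroupType d) (cl : closure_operator S)
    (cl_ord : order_compatible cl) (S_wqo : well_quasi_ordered S) :
  continuous (@star S cl).
Proof.
move=> AB W; rewrite nbhsE => -[O [oO OAB] OW].
have le1 := nbhs_subsets cl_ord S_wqo AB.1.
have le2 := nbhs_subsets cl_ord S_wqo AB.2.
exists ([set A | \val A `<=` \val AB.1], [set B | \val B `<=` \val AB.2]) => //.
move=> AB' [/= leA leB]; apply: OW.
apply: (open_subset_closed (B := star AB)) => //.
have [mulAB _] := star_subset AB (star AB).
apply/star_subset => a b /leA Aa /leB Bb.
exact: mulAB.
Qed.

(** The componentwise limit of an ultrafilter that contains the preimage is again
    in the preimage, because its product is contained in a cluster point, taken
    in [O], of the image ultrafilter. *)
Lemma star_preimage_compact (d : Order.disp_t)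
    (S : semilatticeOrderedSemigroupType d) (cl : closure_operator S)
    (cl_alg : algebraic cl) (cl_ord : order_compatible cl)
    (S_wqo : well_quasi_ordered S) (O : set (closed_sets cl)) :
  open O -> compact O -> compact (@star S cl @^-1` O).
Proof.
move=> oO cO; rewrite compact_ultra => U UU UO.
have FU : Filter U := ultra_proper (UltraFilter := UU).
pose lim (f : closed_sets cl * closed_sets cl -> closed_sets cl)
    : closed_sets cl :=
  SigSub (mem_set (cl_liminf cl_alg f FU)
    : (liminf U f : hull_kernel S) \in closed_sets cl).
exists (lim fst, lim snd).
have leA : \forall AB \near U, \val AB.1 `<=` liminf U fst.
  exact: ultra_subset_liminf.
have leB : \forall AB \near U, \val AB.2 `<=` liminf U snd.
  exact: ultra_subset_liminf.
split; last first.
  (* Pairs below the limit lie in each of its neighbourhoods. *)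
  move=> W [[P Q] [/= nP nQ] PQW].
  apply: filterS (filterI leA leB) => -[A' B'] [/= A'A B'B]; apply: PQW.
  move: nP nQ; rewrite !nbhsE => -[P' [oP P'A] P'P] [Q' [oQ Q'B] Q'Q].
  split; [apply: P'P|apply: Q'Q].
    exact: open_subset_closed P'A.
  exact: open_subset_closed Q'B.
have [C [OC clC]] : O `&` cluster (@star S cl @ U) !=set0 by exact: cO.
have nC := nbhs_subsets cl_ord S_wqo C.
have leC : \forall AB \near U, \val (star AB) `<=` (\val C : set S).
  have [//|notC] := in_ultra_setVsetC
    [set AB : closed_sets cl * closed_sets cl | \val (star AB) `<=` \val C] UU.
  (* Otherwise almost all images would avoid a neighbourhood of [C]. *)
  pose N := [set D : closed_sets cl | ~ (\val D `<=` (\val C : set S))].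
  by have [D [ND DC]] := clC N _ notC nC.
apply: (open_subset_closed (B := C)) => //.
apply/star_subset => a b Aa Bb.
(* A single pair [AB] has [a] and [b] in its components and product below [C]. *)
have [AB [[ABa ABb] /star_subset mulC]] :=
  filter_ex (filterI (filterI Aa Bb) leC).
exact: mulC.
Qed.

Theorem corollary4p14 (d : Order.disp_t)
    (S : semilatticeOrderedSemigroupType d) (cl : closure_operator S)
    (cl_alg : algebraic cl) (cl_ord : order_compatible cl)
    (S_wqo : well_quasi_ordered S) :
  spectral_map (@star S cl).
Proof.
move=> O oO cO; split; first exact: star_preimage_compact.
by have /continuousP := star_continuous cl_ord S_wqo; exact.
Qed.
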